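(* With the operator $A$, its product-convolution approximation $\widetilde A$, and the function $F:\mathbf{\Omega}\times\mathbf{\Omega}\to\mathbb{R}$ defined in the context, one has $$\|\widetilde A - A\| \le \|F\|,$$ where both norms are Frobenius norms, i.e. $\|M\| = \left(\sum_{(y,x)\in\mathbf{\Omega}\times\mathbf{\Omega}} |M[y,x]|^2\right)^{1/2}$.
   Context: Boxes. A box in $\mathbb{Z}^d$ is a Cartesian product $\mathbf{C}=\prod_{i=1}^d [c_{\min}^i,c_{\max}^i]$ of integer intervals, and $\mathrm{corners}(\mathbf{C})=\prod_{i=1}^d\{c_{\min}^i,c_{\max}^i\}$. Let $\mathbf{\Omega}\subset\mathbb{Z}^d$ be a (finite) box and $A:l^2(\mathbf{\Omega})\to l^2(\mathbf{\Omega})$ a linear operator with matrix entries $A[y,x]$, $y,x\in\mathbf{\Omega}$. For sets $X,Y\subset\mathbb{Z}^d$, $X-Y=\{x-y:x\in X,y\in Y\}$, and similarly for $X-p$ with $p$ a point. $\mathbb{1}_X$ is the indicator function of $X$. Adaptive grid. $\mathcal{T}$ is a finite binary tree of boxes (cells) contained in $\mathbf{\Omega}$, with root $\mathbf{\Omega}$; each non-leaf cell $\mathbf{C}$ is subdivided in some coordinate direction $i$ into two child cells sharing an internal facet (i.e. for some integer $m$ with $c_{\min}^i<m<c_{\max}^i$, the interval $[c_{\min}^i,c_{\max}^i]$ is replaced by $[c_{\min}^i,m]$ in one child and by $[m,c_{\max}^i]$ in the other). The sample points $p_1,\dots,p_r$ are the distinct elements of $\bigcup_{\mathbf{C}\in\mathcal{T}}\mathrm{corners}(\mathbf{C})$.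 $\mathrm{cells}(p_k)$ is the set of all leaf cells of $\mathcal{T}$ that contain $p_k$, and $U_k=\bigcup_{\mathbf{C}\in\mathrm{cells}(p_k)}\mathbf{C}$. Write $j\in\mathrm{nbrs}(k)$ if some leaf cell contains both $p_k$ and $p_j$ (so $k\in\mathrm{nbrs}(k)$). Weighting functions. $\{w_k\}_{k=1}^r$ is a partition of unity on $\mathbf{\Omega}$ subordinate to $\{U_k\}$: $w_k\ge 0$, $w_k[x]=0$ for $x\notin U_k$, and $\sum_{k=1}^r w_k[x]=1$ for all $x\in\mathbf{\Omega}$. Impulse responses and their extension. $\varphi_k[z]=(A\delta_{p_k})[z+p_k]=A[z+p_k,p_k]$ for $z\in\mathbf{\Omega}-p_k$, where $\delta_p$ is the Kronecker delta at $p$; $\varphi_k$ is taken to be $0$ elsewhere. Let $$c_k=\mathbb{1}_{\mathbf{\Omega}-p_k}+\sum_{j\in\mathrm{nbrs}(k),\,j\ne k}\mathbb{1}_{(\mathbf{\Omega}-p_j)\setminus(\mathbf{\Omega}-p_k)},$$ $v_k[z]=1/c_k[z]$ if $c_k[z]\neq 0$ and $v_k[z]=0$ otherwise; $v_k^{(k)}=v_k\cdot\mathbb{1}_{\mathbf{\Omega}-p_k}$, and $v_k^{(j)}=v_k\cdot\mathbb{1}_{(\mathbf{\Omega}-p_j)\setminus(\mathbf{\Omega}-p_k)}$ for $j\in\mathrm{nbrs}(k)$, $j\neq k$ (all functions on $\mathbb{Z}^d$, $\cdot$ denoting pointwise multiplication). The extended impulse responses are $\varphi_k^E=\sum_{j\in\mathrm{nbrs}(k)}v_k^{(j)}\cdot\varphi_j$.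 Approximation. $\widetilde A f=\sum_{k=1}^r\varphi_k^E*(w_k\cdot f)$ (evaluated on $\mathbf{\Omega}$), where $(\psi*g)[y]=\sum_{x\in\mathbb{Z}^d}g[x]\psi[y-x]$ and functions are extended by zero as needed. Its matrix entries are $\widetilde A[y,x]=\sum_{k=1}^r w_k[x]\varphi_k^E[y-x]$, $y,x\in\mathbf{\Omega}$. Failure of local translation-invariance. Let $U_k^E=\bigcup_{j\in\mathrm{nbrs}(k)}U_j$, and $$\mu_k^E=\{(y,x):x\in U_k^E,\ y\in\mathbf{\Omega},\ y-x+p_k\in\mathbf{\Omega}\}.$$ For $(y,x)\in\mu_k^E$ let $F_k[y,x]=A[y-x+p_k,p_k]-A[y,x]$, and for $(y,x)\in\mathbf{\Omega}\times\mathbf{\Omega}$ let $$F[y,x]=\max_{k:(y,x)\in\mu_k^E}|F_k[y,x]|.$$ *)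

(* Defs.v *)
From HB Require Import structures.
From mathcomp Require Import all_boot all_order all_algebra.
From mathcomp Require Import finmap complex.

Set Implicit Arguments.
Unset Strict Implicit.
Unset Printing Implicit Defensive.

Import Order.TTheory GRing.Theory Num.Theory.

Local Open Scope ring_scope.
Local Open Scope complex_scope.

Notation point d := 'rV[int]_d.

Record box d := Box { cmin : point d; cmax : point d }.

Definition in_box d (C : box d) (x : point d) : bool :=
  [forall i, cmin C 0 i <= x 0 i <= cmax C 0 i].

Canonical box_predType d := PredType (@in_box d).

Definition nonempty_box d (C : box d) : bool :=
  [forall i, cmin C 0 i <= cmax C 0 i].

Definition is_corner d (C : box d) (x : point d) : bool :=
  [forall i, (x 0 i == cmin C 0 i) || (x 0 i == cmax C 0 i)].

(* A bound on the side lengths of C. *)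
Definition box_size d (C : box d) : nat :=
  \max_(i < d) absz (cmax C 0 i - cmin C 0 i)%R.

(* The set of points of a box; see in_box_points. *)
Definition box_points d (C : box d) : {fset point d} :=
  [fset x : point d in [seq (cmin C + \row_i (f i : nat)%:Z)%R
                       | f : {ffun 'I_d -> 'I_(box_size C).+1}]
   | x \in C]%fset.

Lemma in_box_points d (C : box d) x : (x \in box_points C) = (x \in C).
Proof.
rewrite in_fset /= inE; case: (boolP (x \in C)) => [xC|]; last by rewrite andbF.
rewrite andbT; apply/mapP.
exists [ffun i => inord (absz (x 0 i - cmin C 0 i)%R)]; first by rewrite mem_enum.
apply/rowP => i; have /andP[lex xle] := forallP xC i.
rewrite !mxE !ffunE inordK; first by rewrite gez0_abs ?subr_ge0 // addrC subrK.
rewrite ltnS; apply: leq_trans (leq_bigmax i).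
by rewrite -lez_nat !gez0_abs ?subr_ge0 ?lerB // (le_trans lex).
Qed.

Definition set_coord d (x : point d) (i : 'I_d) (m : int) : point d :=
  \row_j (if j == i then m else x 0 j).

Definition lower_half d (C : box d) i m := Box (cmin C) (set_coord (cmax C) i m).
Definition upper_half d (C : box d) i m := Box (set_coord (cmin C) i m) (cmax C).

(* grid C is the type of the subdivision trees with root cell C. *)
Inductive grid d (C : box d) : Type :=
| Leaf
| Node (i : 'I_d) (m : int) of cmin C 0 i < m < cmax C 0 i
    & grid (lower_half C i m) & grid (upper_half C i m).

Fixpoint cells d (C : box d) (T : grid C) : seq (box d) :=
  C :: match T with
       | Leaf => [::]
       | Node _ _ _ T1 T2 => cells T1 ++ cells T2
       end.

Fixpoint leaves d (C : box d) (T : grid C) : seq (box d) :=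
  match T with
  | Leaf => [:: C]
  | Node _ _ _ T1 T2 => leaves T1 ++ leaves T2
  end.

(* p enumerates, without repetition, the corners of all the cells of T. *)
Definition is_sampling d (Omega : box d) (T : grid Omega) r
    (p : 'I_r -> point d) : Prop :=
  injective p /\
  forall x, (x \in codom p) = has (fun C => is_corner C x) (cells T).

Section AdaptiveGrid.

Variables (d : nat) (Omega : box d) (T : grid Omega).
Variables (r : nat) (p : 'I_r -> point d).

Definition cells_at (k : 'I_r) : seq (box d) := [seq C <- leaves T | p k \in C].

Definition U (k : 'I_r) : {pred point d} :=
  [pred x | has (fun C : box d => x \in C) (cells_at k)].

Definition nbrs (k : 'I_r) : {pred 'I_r} :=
  [pred j | has (fun C : box d => (p k \in C) && (p j \in C)) (leaves T)].

Definition UE (k : 'I_r) : {pred point d} :=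
  [pred x | [exists j in nbrs k, x \in U j]].

Definition muE (k : 'I_r) : {pred point d * point d} :=
  [pred yx | [&& yx.2 \in UE k, yx.1 \in Omega & yx.1 - yx.2 + p k \in Omega]].

(* The set Omega - p_k. *)
Definition shifted (k : 'I_r) : {pred point d} := [pred z | z + p k \in Omega].

End AdaptiveGrid.

Section ProductConvolution.

Variables (R : rcfType) (d : nat) (Omega : box d).

(* Complex-valued functions on Omega; operators between real-valued functions are
   the ones with real entries. *)
Definition l2 := {ffun box_points Omega -> R[i]^o}.

Definition extend (f : l2) (x : point d) : R[i] :=
  if insub x is Some u then f u else 0.

Definition delta (q : point d) : l2 := [ffun x => (val x == q)%:R].

(* B[y, x], with value 0 when y or x lies outside of Omega. *)
Definition entry (B : l2 -> l2) (y x : point d) : R[i] := extend (B (delta x)) y.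

(* (psi * g)[y]; g vanishes outside of Omega, so the sum over Z^d reduces to a
   sum over Omega. *)
Definition conv (psi : point d -> R[i]) (g : l2) (y : point d) : R[i] :=
  \sum_(x : box_points Omega) g x * psi (y - val x).

(* Rcomplex R is R[i] with its R-valued norm, so that V can be R or Rcomplex R. *)
Definition frobenius (V : normedZmodType R)
    (M : box_points Omega -> box_points Omega -> V) : R :=
  Num.sqrt (\sum_y \sum_x `|M y x| ^+ 2).

Definition op_frobenius (B : l2 -> l2) : R :=
  frobenius (fun y x => entry B (val y) (val x) : Rcomplex R).

Variables (T : grid Omega) (r : nat) (p : 'I_r -> point d).

Definition partition_of_unity (w : 'I_r -> {ffun box_points Omega -> R}) : Prop :=
  [/\ forall k x, 0 <= w k x,
      forall k x, val x \notin U T p k -> w k x = 0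
    & forall x, \sum_k w k x = 1].

(* The indicator function of Omega - p_k for j = k, and of
   (Omega - p_j) \ (Omega - p_k) for j <> k. *)
Definition piece (k j : 'I_r) (z : point d) : R :=
  if j == k then (z \in shifted Omega p k)%:R
  else ((z \in shifted Omega p j) && (z \notin shifted Omega p k))%:R.

Definition c (k : 'I_r) (z : point d) : R :=
  piece k k z + \sum_(j in nbrs T p k | j != k) piece k j z.

Definition v (k : 'I_r) (z : point d) : R :=
  if c k z != 0 then 1 / c k z else 0.

Definition vpiece (k j : 'I_r) (z : point d) : R := v k z * piece k j z.

Variables (A : {linear l2 -> l2}) (w : 'I_r -> {ffun box_points Omega -> R}).

Definition phi (k : 'I_r) (z : point d) : R[i] := extend (A (delta (p k))) (z + p k).

Definition phiE (k : 'I_r) (z : point d) : R[i] :=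
  \sum_(j in nbrs T p k) (vpiece k j z)%:C * phi j z.

Definition Atilde (f : l2) : l2 :=
  [ffun y => \sum_k conv (phiE k) [ffun x => (w k x)%:C * f x] (val y)].

Definition Fk (k : 'I_r) (y x : point d) : Rcomplex R :=
  entry A (y - x + p k) (p k) - entry A y x.

(* Every pair in Omega x Omega lies in some muE k and the norms are nonnegative,
   so the default value 0 does not alter the maximum. *)
Definition F (y x : box_points Omega) : R :=
  \big[Num.max/0]_(k | (val y, val x) \in muE T p k) `|Fk k (val y) (val x)|.

End ProductConvolution.

(* Main.v *)
Require Import Defs.
From mathcomp Require Import all_boot all_order all_algebra.
From mathcomp Require Import finmap complex.
From mathcomp Require Import zify.

Set Implicit Arguments.
Unset Strict Implicit.
Unset Printing Implicit Defensive.

Import Order.TTheory GRing.Theory Num.Theory.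
Import ComplexField.Normc.
Local Open Scope ring_scope.
Local Open Scope complex_scope.

(** The bound holds entry by entry, because the error at (y, x) is a convex
    combination of failures of translation-invariance at (y, x).  By
    [entry_Atilde] and the definition of the extended impulse responses,
    Atilde[y, x] is the sum over k, and over the neighbours j of k, of
<<
      w_k[x] v_k^(j)[y - x] A[y - x + p_j, p_j].
>>
    If these nonnegative weights sum to 1, subtracting A[y, x] replaces every
    entry of A by the corresponding F_j[y, x].  Moreover only pairs (y, x) in
    mu_j^E receive a nonzero weight ([mem_muE]): w_k[x] <> 0 puts x in U_k,
    hence in U_j^E as j and k are neighbours, and v_k^(j)[y - x] <> 0 puts
    y - x + p_j in Omega.  So each term is at most F[y, x].

    The w_k sum to 1 by assumption.  For k with x in U_k, the v_k^(j)[y - x] sum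
    to 1 as soon as c_k[y - x] is nonzero ([sum_vpiece]), that is, as soon as
    some neighbour p_j of p_k satisfies y - x + p_j in Omega.  This is where the
    geometry enters ([nbr_shifted]): a leaf cell containing both p_k and x has
    a corner which the translation by y - x keeps inside Omega
    ([corner_translate]), and this corner is a sample point. *)

(** * Leaf cells *)

Definition sub_box (d : nat) (C D : box d) : bool :=
  [forall i, (cmin D 0 i <= cmin C 0 i) && (cmax C 0 i <= cmax D 0 i)].

Lemma sub_box_refl d (C : box d) : sub_box C C.
Proof. by apply/forallP => i; rewrite !lexx. Qed.

Lemma sub_box_trans d (D C E : box d) :
  sub_box C D -> sub_box D E -> sub_box C E.
Proof.
move=> /forallP CD /forallP DE; apply/forallP => i.
have /andP[a b] := CD i; have /andP[a' b'] := DE i.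
by rewrite (le_trans a' a) (le_trans b b').
Qed.

Lemma sub_lower_half d (C : box d) i m :
  m < cmax C 0 i -> sub_box (lower_half C i m) C.
Proof.
move=> mC; apply/forallP => j; rewrite /= lexx mxE.
by case: eqP => [->|_]; [exact: ltW | exact: lexx].
Qed.

Lemma sub_upper_half d (C : box d) i m :
  cmin C 0 i < m -> sub_box (upper_half C i m) C.
Proof.
move=> Cm; apply/forallP => j; rewrite /= lexx andbT mxE.
by case: eqP => [->|_]; [exact: ltW | exact: lexx].
Qed.

(** Boxes carry no boolean equality, so membership of C in the leaves is
    expressed by its effect: any property of C holds for some leaf.  Leaves lie
    in the root cell because both halves of a box do. *)
Lemma has_leaf d (D : box d) (T : grid D) (a : pred (box d)) :
  has a (leaves T) ->
  exists C, [/\ a C, sub_box C D & forall b : pred (box d), b C -> has b (leaves T)].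
Proof.
elim: T => {D} [D|D i m /andP[Dm mD] T1 IH1 T2 IH2] /=.
  by rewrite orbF => aD; exists D; split=> // [|b ->]; rewrite ?sub_box_refl.
rewrite has_cat => /orP[/IH1|/IH2] [C [aC CD bC]]; exists C; split=> //.
- exact: sub_box_trans CD (sub_lower_half mD).
- by move=> b /bC; rewrite has_cat => ->.
- exact: sub_box_trans CD (sub_upper_half Dm).
- by move=> b /bC; rewrite has_cat orbC => ->.
Qed.

Lemma has_cells d (D : box d) (T : grid D) (a : pred (box d)) :
  has a (leaves T) -> has a (cells T).
Proof.
elim: T => {D} [D|D i m Dm T1 IH1 T2 IH2] //=.
by rewrite !has_cat => /orP[/IH1->|/IH2->]; rewrite ?orbT.
Qed.

(** In each coordinate, q takes the lower end of C if y is above x and the upper end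
    otherwise: the coordinate of y - x + q then lies between those of q and y,
    both of which are in D. *)
Lemma corner_translate d (C D : box d) (x y : point d) :
  sub_box C D -> x \in C -> y \in D ->
  exists q, [/\ is_corner C q, q \in C & y - x + q \in D].
Proof.
move=> /forallP CD /forallP xC /forallP yD.
exists (\row_i if x 0 i <= y 0 i then cmin C 0 i else cmax C 0 i).
split; apply/forallP => i; rewrite !mxE.
- by case: ifP; rewrite eqxx ?orbT.
- by have /andP[a b] := xC i; case: ifP; rewrite lexx ?andbT (le_trans a b).
have := CD i; have := xC i; have := yD i.
move: (cmin _ _ _) (cmin _ _ _) (cmax _ _ _) (cmax _ _ _) (x 0 i) (y 0 i).
move=> Dl Cl Du Cu xi yi; case: ifPn; lia.
Qed.

(** * Sample points *)

Section Sampling.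

Variables (d : nat) (Omega : box d) (T : grid Omega).
Variables (r : nat) (p : 'I_r -> point d).

Lemma in_U k x :
  (x \in U T p k) = has (fun C : box d => (p k \in C) && (x \in C)) (leaves T).
Proof.
rewrite inE /cells_at; elim: (leaves T) => //= C s IH.
by case: (p k \in C); rewrite /= IH.
Qed.

Lemma U_self k x : x \in U T p k -> k \in nbrs T p k.
Proof.
by rewrite in_U; apply: sub_has => C /andP[pkC _]; apply/andP.
Qed.

Lemma nbrs_sym j k : (j \in nbrs T p k) = (k \in nbrs T p j).
Proof. by apply: eq_has => C; rewrite /= andbC. Qed.

Lemma mem_muE j k x y :
    x \in U T p k -> y \in Omega -> j \in nbrs T p k ->
    y - x \in shifted Omega p j ->
  (y, x) \in muE T p j.
Proof.
move=> xU yO jk yxj; apply/and3P; split=> //.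
by apply/existsP; exists k; rewrite nbrs_sym jk.
Qed.

(** The corners of the leaf cells shared by p_k and x are themselves sample
    points, and neighbours of p_k; [corner_translate] selects the right one. *)
Lemma nbr_shifted k x y :
    is_sampling T p -> x \in U T p k -> y \in Omega ->
  exists2 j, j \in nbrs T p k & y - x \in shifted Omega p j.
Proof.
move=> [_ pT]; rewrite in_U => /has_leaf[C [/andP[pkC xC] CO CT]] yO.
have [q [qC Cq qO]] := corner_translate CO xC yO.
have /codomP[j qj] : q \in codom p by rewrite pT; apply/has_cells/CT.
by exists j; [apply: CT; rewrite pkC -qj | rewrite inE -qj].
Qed.

End Sampling.

(** * Convex combinations *)

Lemma normc_real (R : rcfType) (a : R) : normc a%:C = `|a|.
Proof. by rewrite /= expr0n addr0 sqrtr_sqr. Qed.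

(** The bound on f i is only required where a i is nonzero: indices of weight 0
    may correspond to data that are not controlled. *)
Lemma normc_convex_sub (R : rcfType) (I : finType) (P : pred I)
    (a : I -> R) (f : I -> R[i]) (g : R[i]) (M : R) :
    (forall i, P i -> 0 <= a i) -> \sum_(i | P i) a i = 1 ->
    (forall i, P i -> a i != 0 -> normc (f i - g) <= M) ->
  normc (\sum_(i | P i) (a i)%:C * f i - g) <= M.
Proof.
move=> a0 a1 fM.
have -> : \sum_(i | P i) (a i)%:C * f i - g =
          \sum_(i | P i) (a i)%:C * (f i - g).
  under [RHS]eq_bigr do rewrite mulrBr.
  by rewrite sumrB -mulr_suml -rmorph_sum a1 mul1r.
apply: le_trans (ler_norm_sum (V := Rcomplex R) _ _ _) _.
rewrite -[M]mul1r -a1 mulr_suml; apply: ler_sum => i Pi.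
rewrite [leLHS]normcM normc_real (ger0_norm (a0 i Pi)).
have [->|ai] := eqVneq (a i) 0; first by rewrite !mul0r.
exact: ler_wpM2l (a0 i Pi) _ _ (fM i Pi ai).
Qed.

Section Weights.

Variables (R : rcfType) (d : nat) (Omega : box d) (T : grid Omega).
Variables (r : nat) (p : 'I_r -> point d).

Lemma piece_ge0 k j z : 0 <= piece R Omega p k j z.
Proof. by rewrite /piece; case: ifP. Qed.

Lemma piece_neq0 k j z : piece R Omega p k j z != 0 -> z \in shifted Omega p j.
Proof.
rewrite /piece; case: (j =P k) => [->|_]; first by case: (z \in _); rewrite ?eqxx.
by case: (z \in shifted Omega p j); rewrite ?eqxx.
Qed.

Lemma c_sum_piece k z :
  k \in nbrs T p k ->
  c R T p k z = \sum_(j in nbrs T p k) piece R Omega p k j z.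
Proof. by move=> kk; rewrite (bigD1 k). Qed.

Lemma vpiece_ge0 k j z : 0 <= vpiece R T p k j z.
Proof.
rewrite mulr_ge0 ?piece_ge0 // /v; case: ifP => // _.
rewrite divr_ge0 // addr_ge0 ?piece_ge0 // sumr_ge0 // => i _.
exact: piece_ge0.
Qed.

(** v_k is the inverse of c_k, which is the sum of the pieces, so only c_k <> 0 is
    at stake.  The piece of k is 1 at z if z is in Omega - p_k, and otherwise the
    piece of j is. *)
Lemma sum_vpiece k j z :
    k \in nbrs T p k -> j \in nbrs T p k -> z \in shifted Omega p j ->
  \sum_(i in nbrs T p k) vpiece R T p k i z = 1.
Proof.
move=> kk jk zj; rewrite -mulr_sumr -c_sum_piece //.
suff c0 : c R T p k z != 0 by rewrite /v c0 div1r mulVf.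
rewrite c_sum_piece //; apply/eqP => /psumr_eq0P s0.
have {}s0 i : i \in nbrs T p k -> piece R Omega p k i z = 0.
  by apply: s0 => *; exact: piece_ge0.
have [zk|zk] := boolP (z \in shifted Omega p k).
  by have /eqP := s0 k kk; rewrite /piece eqxx zk oner_eq0.
have jk' : j != k by apply: contraNneq zk => <-.
by have /eqP := s0 j jk; rewrite /piece (negPf jk') zj zk oner_eq0.
Qed.

End Weights.

(** * Matrix entries *)

Section Entries.

Variables (R : rcfType) (d : nat) (Omega : box d) (T : grid Omega).
Variables (r : nat) (p : 'I_r -> point d).
Variables (A : {linear l2 R Omega -> l2 R Omega}).
Variables (w : 'I_r -> {ffun box_points Omega -> R}).

Lemma entryE (B : l2 R Omega -> l2 R Omega) (y x : box_points Omega) :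
  entry B (val y) (val x) = B (delta R Omega (val x)) y.
Proof. by rewrite /entry /extend valK. Qed.

Lemma entry_Atilde (y x : box_points Omega) :
  entry (Atilde T p A w) (val y) (val x) =
  \sum_k (w k x)%:C * phiE T p A k (val y - val x).
Proof.
rewrite entryE ffunE; apply: eq_bigr => k _.
rewrite /conv (bigD1 x) //= big1 => [|x' x'x].
  by rewrite !ffunE eqxx mulr1 addr0.
by rewrite !ffunE val_eqE (negPf x'x) mulr0 mul0r.
Qed.

(** The double convex combination is treated one index at a time: over k with the
    weights w_k[x], then, for each k of nonzero weight, over the neighbours of k
    with the weights v_k^(j)[y - x]. *)
Lemma Atilde_sub_le_F (y x : box_points Omega) :
    is_sampling T p -> partition_of_unity T p w ->
  normc (entry (Atilde T p A w \- A) (val y) (val x)) <= F T p A y x.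
Proof.
move=> hp [w0 wU w1].
have -> : entry (Atilde T p A w \- A) (val y) (val x) =
    entry (Atilde T p A w) (val y) (val x) - entry A (val y) (val x).
  by rewrite !entryE /= !ffunE.
have yO : val y \in Omega by rewrite -in_box_points (valP y).
rewrite entry_Atilde; apply: normc_convex_sub => // k _ wk.
have xU : val x \in U T p k by apply: contraR wk => /wU ->.
have [j0 j0k yxj0] := nbr_shifted hp xU yO.
apply: normc_convex_sub => [j _||j jk].
- exact: vpiece_ge0.
- exact: sum_vpiece (U_self xU) j0k yxj0.
rewrite mulf_eq0 => /norP[_ /piece_neq0 yxj].
exact: (@le_bigmax_cond _ _ _ _ j _ (fun j => `|Fk p A j (val y) (val x)|)
  (mem_muE xU yO jk yxj)).
Qed.

End Entries.

Theorem theorem4p5 (R : rcfType) (d : nat) (Omega : box d)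
    (hOmega : nonempty_box Omega) (T : grid Omega)
    (r : nat) (p : 'I_r -> point d) (hp : is_sampling T p)
    (w : 'I_r -> {ffun box_points Omega -> R}) (hw : partition_of_unity T p w)
    (A : {linear l2 R Omega -> l2 R Omega}) :
  op_frobenius (Atilde T p A w \- A) <= frobenius (F T p A).
Proof.
apply: ler_wsqrtr; apply: ler_sum => y _; apply: ler_sum => x _.
have le_F := Atilde_sub_le_F A y x hp hw.
by apply: lerXn2r; rewrite ?nnegrE ?normr_ge0 // (le_trans le_F) ?ler_norm.
Qed.
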